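(* Let $A$ and $M$ be complex Hermitian invertible matrices of the same dimension with different inertia. Then $M^{-1}A$ has at least one negative real eigenvalue, and thus the stationary iteration $$M x_{k+1} = N x_k + b,\qquad k=0,1,\ldots,\qquad N = M-A,$$ for the linear system $Ax=b$ cannot be contractive.
   Context: The inertia of a complex Hermitian matrix is the triple (number of positive eigenvalues, number of zero eigenvalues, number of negative eigenvalues), counted with multiplicity. Given an invertible linear system $Ax=b$, one splits $A=M-N$ with $M$ invertible (the splitting matrix or preconditioner) and, from a starting vector $x_0$, solves $Mx_{k+1}=Nx_k+b$ for $k=0,1,\ldots$. This stationary iteration is called contractive if all eigenvalues of $M^{-1}N = I-M^{-1}A$ lie strictly inside the unit disc (equivalently, the sequence $\{x_k\}$ converges to the solution for every $x_0$). *)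

(* Defs.v *)
From HB Require Import structures.
From mathcomp Require Import all_boot all_order all_algebra.
From mathcomp Require Export reals complex.

Set Implicit Arguments.
Unset Strict Implicit.
Unset Printing Implicit Defensive.

Import Order.TTheory GRing.Theory Num.Theory.
Local Open Scope ring_scope.
Local Open Scope complex_scope.

(* The order on R[i] is the partial one in which x <= y means that y - x is a
   nonnegative real; in particular 0 < z and z < 0 entail that z is real.
   The norm of z : R[i] is the (real) modulus of z, seen in R[i]. *)

(* The roots of the characteristic polynomial, each listed as many times as
   its multiplicity; the order of the list is irrelevant. *)
Definition eigenvalues (R : realType) (n : nat) (A : 'M[R[i]]_n) : seq R[i] :=
  sval (closed_field_poly_normal (char_poly A)).

Lemma char_poly_eigenvalues (R : realType) (n : nat) (A : 'M[R[i]]_n) :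
  char_poly A = \prod_(z <- eigenvalues A) ('X - z%:P).
Proof.
rewrite /eigenvalues; case: closed_field_poly_normal => s /= {1}->.
by rewrite (monicP (char_poly_monic A)) scale1r.
Qed.

(* (positive, zero, negative); meant for Hermitian A, whose eigenvalues are all
   real. *)
Definition inertia (R : realType) (n : nat) (A : 'M[R[i]]_n) : nat * nat * nat :=
  (count (fun z => 0 < z) (eigenvalues A),
   count (fun z => z == 0) (eigenvalues A),
   count (fun z => z < 0) (eigenvalues A)).

(* Contractivity of the stationary iteration M x_(k+1) = N x_k + b, where M is
   invertible; it does not depend on b.  The library's eigenvalue is defined
   with row eigenvectors, which gives the same spectrum as column ones. *)
Definition contractive (R : realType) (n : nat) (M N : 'M[R[i]]_n) : Prop :=
  forall z : R[i], eigenvalue (invmx M *m N) z -> `|z| < 1.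

(* Main.v *)
Require Import Defs.
From HB Require Import structures.
From mathcomp Require Import all_boot all_order all_algebra.
From mathcomp Require Import reals complex.
From mathcomp Require Import ring.

Set Implicit Arguments.
Unset Strict Implicit.
Unset Printing Implicit Defensive.

Import Order.TTheory GRing.Theory Num.Theory.
Local Open Scope ring_scope.
Local Open Scope complex_scope.
Local Open Scope sesquilinear_scope.

(* Suppose B = M^-1 A has no negative eigenvalue.  Since B is also invertible,
   no eigenvalue lies on ]-oo, 0], so 'X is a square modulo a real multiple of
   char_poly B (square roots exist modulo each irreducible real factor, and lift
   by Hensel's lemma and the Chinese remainder theorem).  Hence B = S^2 for some
   S = p(B) with p real.  From M B = B^* M we get M S = S^* M, because p is real,
   and so A = M S S = S^* M S: A and M are congruent, and Sylvester's law
   contradicts the difference of the inertias. *)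

(** * Lifting square roots modulo a product of polynomials *)

(* If q divides m this is a Hensel step, otherwise the Chinese remainder theorem. *)
Lemma sqrt_modp_mul (F : fieldType) (a m q p s : {poly F}) :
  (2%:R : F) != 0 -> irreducible_poly q -> ~~ (q %| a) ->
  m %| p ^+ 2 - a -> q %| s ^+ 2 - a ->
  exists r, m * q %| r ^+ 2 - a.
Proof.
move=> two_neq0 q_irr qNa /dvdpP[u pE] /dvdpP[v sE].
have [/dvdpP[w mE]|] := boolP (q %| m); last first.
  rewrite -(irreducible_poly_coprime _ q_irr) => /Bezout_eq1_coprimepP[[x y] /= xy].
  (* This is [p] modulo [m] and [s] modulo [q], because [m * y = 1 - x * q]. *)
  exists (p + m * (y * (s - p))); rewrite Gauss_dvdp; last first.
    by apply/Bezout_eq1_coprimepP; exists (y, x); rewrite /= addrC.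
  apply/andP; split; apply/dvdpP.
    exists (u + 2%:R * p * (y * (s - p)) + m * (y * (s - p)) ^+ 2).
    have -> : (p + m * (y * (s - p))) ^+ 2 - a =
      (p ^+ 2 - a) + m * (2%:R * p * (y * (s - p)) + m * (y * (s - p)) ^+ 2) by ring.
    by rewrite pE; ring.
  have ym : m * y = 1 - x * q by rewrite -xy; ring.
  rewrite mulrA ym.
  exists (v - 2%:R * s * x * (s - p) + q * x ^+ 2 * (s - p) ^+ 2).
  have -> : (p + (1 - x * q) * (s - p)) ^+ 2 - a =
    (s ^+ 2 - a) + q * (q * x ^+ 2 * (s - p) ^+ 2 - 2%:R * s * x * (s - p)) by ring.
  by rewrite sE; ring.
(* Otherwise [q] divides [p], as 2 is a unit, and hence also [a = p ^+ 2 - u * m]. *)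
have qN2p : coprimep q (2%:R * p).
  rewrite irreducible_poly_coprime //; apply: contra qNa => /dvdpP[t tE].
  have -> : a = p ^+ 2 - u * m by rewrite -pE; ring.
  rewrite mE mulrA dvdp_sub ?dvdp_mull //.
  have : q %| 2%:R * p by rewrite tE dvdp_mull.
  rewrite -[2%:R]/(1 *+ 2) -polyC1 -polyCMn mul_polyC dvdpZr //.
case/Bezout_eq1_coprimepP: qN2p => -[x y] /= xy.
(* Newton step: [y] inverts [2 * p] modulo [q], so the linear term cancels [u * m] modulo [m * q],
   which also divides [m ^+ 2]. *)
exists (p - m * (y * u)); apply/dvdpP.
exists (u * x + w * (y * u) ^+ 2).
have -> : (p - m * (y * u)) ^+ 2 - a =
  (p ^+ 2 - a) - m * u * (y * (2%:R * p)) + m ^+ 2 * (y * u) ^+ 2 by ring.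
have -> : y * (2%:R * p) = 1 - x * q by rewrite -[X in X - _]xy; ring.
by rewrite pE mE; ring.
Qed.

(** * Square roots of ['X] modulo real polynomials *)

Section RealQuadratic.
Variable R : realType.
Implicit Types z : R[i].

(** The minimal polynomial of [z] over the reals. *)
Definition real_factor z : {poly R} :=
  if complex.Im z == 0 then 'X - (complex.Re z)%:P
  else 'X^2 - (2%:R * complex.Re z)%:P * 'X + (complex.Re z ^+ 2 + complex.Im z ^+ 2)%:P.

Lemma map_real_factor z : 'X - z%:P %| map_poly (real_complex R) (real_factor z).
Proof.
rewrite dvdp_XsubCl /root /real_factor; case: z => x y /=; case: (y =P 0) => [->|_] /=.
  by rewrite map_polyXsubC hornerXsubC subrr.
rewrite rmorphD rmorphB /= map_polyXn (rmorphM _ (_%:P)) /= map_polyX !map_polyC /=.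
rewrite !hornerE expr2; apply/eqP; simpc.
by apply: (f_equal2 (@Complex R)); ring.
Qed.

Lemma real_factor_irreducible z : irreducible_poly (real_factor z).
Proof.
rewrite /real_factor; case: eqP => [_|/eqP y0]; first exact: irredp_XsubC.
apply: cubic_irreducible.
  rewrite -addrA size_polyDl ?size_polyXn // -mulNr -polyCN.
  by rewrite size_MXaddC; case: ifP => // _; rewrite !ltnS size_polyC_leq1.
move=> x; apply/negP => /rootP; rewrite !hornerE /= => /eqP.
have -> : x ^+ 2 - 2%:R * complex.Re z * x + complex.Re z ^+ 2 + complex.Im z ^+ 2
  = (x - complex.Re z) ^+ 2 + complex.Im z ^+ 2 by ring.
rewrite paddr_eq0 ?sqr_ge0 // => /andP[_].
by rewrite sqrf_eq0 (negPf y0).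
Qed.

Lemma real_factor_ndvdX z : z != 0 -> ~~ (real_factor z %| 'X).
Proof.
move=> z0; apply: contra z0.
rewrite -(dvdp_map (real_complex R)) map_polyX => qX.
have := dvdp_trans (map_real_factor z) qX.
by rewrite dvdp_XsubCl /root hornerX.
Qed.

(** For real [z] a constant works. Otherwise the quotient by [real_factor z] is a copy of the
    complex field in which ['X] stands for [z], and there every element is a square. *)
Lemma real_factor_sqrt z : ~~ (z < 0) ->
  exists s : {poly R}, real_factor z %| s ^+ 2 - 'X.
Proof.
rewrite /real_factor ltcE /= eq_sym; case: eqP => [_|/eqP y0] /= => [|_].
  rewrite -leNgt => x0; exists (Num.sqrt (complex.Re z))%:P.
  by rewrite dvdp_XsubCl /root !hornerE sqr_sqrtr // subrr.
case: z y0 => x y /= y0.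
have [[u v] uv] : exists w : R[i], w ^+ 2 = x +i* y.
  by exists (sqrtc (x +i* y)); rewrite sqr_sqrtc.
have uE : u ^+ 2 - v ^+ 2 = x by move: uv; rewrite expr2; simpc => -[<- _]; ring.
have vE : 2%:R * u * v = y by move: uv; rewrite expr2; simpc => -[_ <-]; ring.
have u0 : 2%:R * u != 0 by apply: contraNneq y0 => uz; rewrite -vE uz mul0r.
(* For w = u + iv one has (w + conj w) w = w^2 + |w|^2, so the linear polynomial
   below takes the value w at w^2 = z. *)
exists ((2%:R * u)^-1 *: ('X + (u ^+ 2 + v ^+ 2)%:P)).
(* The cofactor is constant: [('X + u^2 + v^2)^2 - 4 u^2 'X] is exactly [real_factor z]. *)
apply/dvdpP; exists ((2%:R * u)^-1 ^+ 2)%:P.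
have c1 : ((2%:R * u)^-1 ^+ 2)%:P * (2%:R * u%:P) ^+ 2 = 1 :> {poly R}.
  rewrite -[2%:R]/(1 *+ 2) -polyC1 -polyCMn -polyCM -rmorphXn -polyCM /=.
  by rewrite -exprMn mulVf // expr1n.
rewrite exprZn -mul_polyC -uE -vE -[X in _ - X]mul1r -c1.
set c := ((_ ^+ 2)%:P); rewrite !(rmorphM, rmorphXn, rmorphB, rmorphD, rmorph_nat) /=.
rewrite ?polyCM ?polyC_exp ?polyCD ?polyCB ?polyCN.
ring.
Qed.
End RealQuadratic.

(** Each [z] contributes its whole real factor, so conjugate or multiple roots repeat factors; the
    Hensel case of [sqrt_modp_mul] absorbs the repetitions. *)
Lemma real_sqrt_modp (R : realType) (zs : seq R[i]) :
    (forall z, z \in zs -> z != 0 /\ ~~ (z < 0)) ->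
  exists p : {poly R}, \prod_(z <- zs) ('X - z%:P) %|
    map_poly (real_complex R) (p ^+ 2 - 'X).
Proof.
move=> zsP; suff [p pP] : exists p : {poly R},
    \prod_(z <- zs) real_factor z %| p ^+ 2 - 'X.
  exists p; move: pP; rewrite -(dvdp_map (real_complex R)); apply: dvdp_trans.
  rewrite rmorph_prod /=; elim: (zs) => [|z s IHs]; rewrite ?big_nil ?big_cons //.
  exact: dvdp_mul (map_real_factor z) IHs.
elim: zs zsP => [|z s IHs] zsP; first by exists 0; rewrite big_nil dvd1p.
have [|p pP] := IHs; first by move=> w ws; apply: zsP; rewrite inE ws orbT.
have [z0 zN] := zsP z (mem_head _ _).
have [r rP] := real_factor_sqrt zN.
rewrite big_cons mulrC.
apply: sqrt_modp_mul pP rP; rewrite ?pnatr_eq0 ?real_factor_ndvdX //.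
exact: real_factor_irreducible.
Qed.

(** * Hermitian matrices, diagonal forms and congruence *)

Section Hermitian.
Variable C : numClosedFieldType.

Lemma hermsymmxP n (A : 'M[C]_n) : reflect (A^t* = A) (A \is hermsymmx).
Proof.
by apply: (iffP (is_hermitianmxP _ _ _)); rewrite expr0 scale1r.
Qed.

Lemma adjmxM m n p (A : 'M[C]_(m, n)) (B : 'M[C]_(n, p)) :
  (A *m B)^t* = B^t* *m A^t*.
Proof. by rewrite trmx_mul map_mxM. Qed.

Lemma diag_form n (d : 'rV[C]_n) (x : 'rV[C]_n) :
  (x *m diag_mx d *m x^t*) 0 0 = \sum_i d 0 i * `|x 0 i| ^+ 2.
Proof.
rewrite mxE; apply: eq_bigr => i _.
by rewrite mul_mx_diag !mxE normCK mulrAC mulrA [d 0 i * _]mulrC mulrAC.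
Qed.

(* If d' had more positive entries than d, some x <> 0 supported on those of d'
   would satisfy (x S)_j = 0 wherever d_j > 0, so that x diag(d') x^* would be
   both positive and nonpositive. *)
Lemma card_pos_diag_congr n (d d' : 'rV[C]_n) (S : 'M[C]_n) :
    d \is a realmx -> diag_mx d' = S *m diag_mx d *m S^t* ->
  (#|[pred i | (0 < d' 0 i)%R]| <= #|[pred i | (0 < d 0 i)%R]|)%N.
Proof.
move=> d_real d'E; rewrite leqNgt; apply/negP => lt_d.
set P := [pred i | 0 < d 0 i] in lt_d; set P' := [pred i | 0 < d' 0 i] in lt_d.
pose f := enum_val : 'I_#|P'| -> 'I_n; pose g := enum_val : 'I_#|P| -> 'I_n.
(* This submatrix has more rows than columns, hence a nonzero left kernel. *)
have /rowV0Pn[v /sub_kermxP vS v0] : kermx (mxsub f g S) != 0.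
  rewrite -mxrank_eq0 mxrank_ker subn_eq0 -ltnNge.
  exact: leq_ltn_trans (rank_leq_col _) lt_d.
pose x := v *m rowsub f 1%:M; pose y := x *m S.
have xf i : x 0 (f i) = v 0 i.
  rewrite mxE (bigD1 i) //= !mxE eqxx mulr1 big1 ?addr0 // => j ji.
  by rewrite !mxE (inj_eq enum_val_inj) (negPf ji) mulr0.
have xN i : i \notin P' -> x 0 i = 0.
  move=> iP'; rewrite mxE big1 // => j _; rewrite !mxE.
  case: eqP => [fj|]; rewrite ?mulr0 //.
  by case/negP: iP'; rewrite -fj enum_valP.
have yP i : i \in P -> y 0 i = 0.
  move=> iP; have /matrixP/(_ 0 (enum_rank_in iP i)) := vS.
  rewrite [RHS]mxE => <-; rewrite /y /x -mulmxA mul_rowsub_mx mul1mx !mxE.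
  by apply: eq_bigr => j _; rewrite !mxE /g enum_rankK_in.
(* The sum is also the form of [d] at [y], which vanishes where [d] is positive. *)
have : \sum_i d' 0 i * `|x 0 i| ^+ 2 <= 0.
  rewrite -diag_form d'E !mulmxA -mulmxA -adjmxM diag_form sumr_le0 // => i _.
  have [iP|iP] := boolP (i \in P); first by rewrite yP // normr0 expr0n mulr0 lexx.
  rewrite mulr_le0_ge0 ?exprn_ge0 // real_leNgt ?real0 //.
  by move/mxOverP: d_real; apply.
apply/negP/negbT/lt_geF.
have /rV0Pn[j vj] := v0.
have ge0 i : 0 <= d' 0 i * `|x 0 i| ^+ 2.
  have [iP|iP] := boolP (i \in P'); first by rewrite mulr_ge0 ?exprn_ge0 // ltW.
  by rewrite xN // normr0 expr0n mulr0.
rewrite (bigD1 (f j)) //= ltr_wpDr ?sumr_ge0 //.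
by rewrite mulr_gt0 ?exprn_gt0 ?normr_gt0 ?xf //; apply: (enum_valP j).
Qed.

Lemma char_poly_conj n (P A : 'M[C]_n) :
  P \in unitmx -> char_poly (invmx P *m A *m P) = char_poly A.
Proof.
move=> Pu; have polyCP : map_mx polyC (invmx P) *m map_mx polyC P = 1%:M.
  by rewrite -map_mxM mulVmx // map_mx1.
rewrite /char_poly /char_poly_mx.
have -> : 'X%:M - map_mx polyC (invmx P *m A *m P) =
    map_mx polyC (invmx P) *m ('X%:M - map_mx polyC A) *m map_mx polyC P.
  by rewrite mulmxBr mulmxBl !map_mxM scalar_mxC -[X in _ = X - _]mulmxA polyCP mulmx1.
by rewrite !det_mulmx mulrAC -det_mulmx polyCP det1 mul1r.
Qed.

Lemma char_poly_spectral n (A : 'M[C]_n) : A \is hermsymmx ->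
  char_poly A = \prod_i ('X - (spectral_diag A 0 i)%:P).
Proof.
move=> /hermitian_normalmx/orthomx_spectralP {1}->.
rewrite char_poly_conj ?spectral_unit // char_poly_trig ?diag_mx_is_trig //.
by apply: eq_bigr => i _; rewrite mxE eqxx mulr1n.
Qed.

(** The unitary diagonalizations of [A] and [B] are absorbed into [S]. *)
Lemma spectral_congr n (A B S : 'M[C]_n) :
    A \is hermsymmx -> B \is hermsymmx -> B = S *m A *m S^t* ->
  exists T, diag_mx (spectral_diag B) = T *m diag_mx (spectral_diag A) *m T^t*.
Proof.
move=> /hermitian_normalmx/orthomx_spectralP + /hermitian_normalmx/orthomx_spectralP.
move: (spectral_unitarymx A) (spectral_unitarymx B).
move: (spectralmx A) (spectralmx B) (spectral_diag A) (spectral_diag B).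
move=> P Q d e Pu Qu AE BE BS; exists (Q *m S *m invmx P).
rewrite !adjmxM invmx_unitary // trmxCK.
transitivity (Q *m B *m Q^t*).
  by rewrite -invmx_unitary // BE !mulmxA mulmxK ?mulmxV ?mul1mx ?unitarymx_unit.
by rewrite BS AE invmx_unitary // !mulmxA.
Qed.
End Hermitian.

(** * Sylvester's law of inertia *)

Section Inertia.
Variables (R : realType) (n : nat).
Implicit Types A B S : 'M[R[i]]_n.

Lemma perm_eigenvalues A : A \is hermsymmx ->
  perm_eq (eigenvalues A) [seq spectral_diag A 0 i | i <- enum 'I_n].
Proof.
move=> hA; apply: prod_XsubC_eq.
by rewrite -char_poly_eigenvalues char_poly_spectral // big_map big_enum.
Qed.

Lemma count_eigenvalues A (P : pred R[i]) : A \is hermsymmx ->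
  count P (eigenvalues A) = #|[pred i | P (spectral_diag A 0%R i)]|.
Proof.
move=> /perm_eigenvalues/permP ->; rewrite count_map enumT cardE /enum_mem size_filter.
exact: eq_count.
Qed.

(** The eigenvalues are real, so trichotomy applies; the zero count is thereby determined by the
    other two. *)
Lemma inertia_sum A : A \is hermsymmx ->
  (count (fun z => 0 < z)%R (eigenvalues A) +
   count (fun z => z == 0)%R (eigenvalues A) +
   count (fun z => z < 0)%R (eigenvalues A) = n)%N.
Proof.
move=> hA; have /permP cE := perm_eigenvalues hA.
rewrite !cE -[RHS]card_ord cardE -(size_map (spectral_diag A 0)).
have : all (fun z => z \is Num.real) [seq spectral_diag A 0 i | i <- enum 'I_n].
  apply/allP => _ /mapP[i _ ->].
  by have /mxOverP := hermitian_spectral_diag_real hA; apply.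
elim: map => //= z s IHs /andP[z_real /IHs <-].
by have [] := real_ltgt0P z_real; rewrite ?add1n ?addnS ?add0n.
Qed.

Lemma count_eigenvalues_congr A B S :
    A \is hermsymmx -> B \is hermsymmx -> B = S *m A *m S^t* ->
  (count (fun z => 0 < z)%R (eigenvalues B) <=
   count (fun z => 0 < z)%R (eigenvalues A))%N /\
  (count (fun z => z < 0)%R (eigenvalues B) <=
   count (fun z => z < 0)%R (eigenvalues A))%N.
Proof.
move=> hA hB BS; have [T TE] := spectral_congr hA hB BS.
have realA := hermitian_spectral_diag_real hA.
have le_eq (a b a' b' : nat) : a = a' -> b = b' -> (a' <= b' -> a <= b)%N by move=> -> ->.
split; apply: le_eq (count_eigenvalues _ hB) (count_eigenvalues _ hA) _.
  exact: card_pos_diag_congr TE.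
(* Negative entries are counted as the positive entries of the opposite diagonals. *)
have : diag_mx (- spectral_diag B) = T *m diag_mx (- spectral_diag A) *m T^t*.
  by rewrite !raddfN /= TE mulNmx.
have realNA : - spectral_diag A \is a realmx.
  by apply/mxOverP => i j; rewrite mxE realN; move/mxOverP: realA; apply.
move/(card_pos_diag_congr realNA).
have oppE (d : 'rV[R[i]]_n) : #|[pred i | (0 < (- d) 0 i)%R]| = #|[pred i | (d 0 i < 0)%R]|.
  by apply: eq_card => i; rewrite !inE mxE oppr_gt0.
by rewrite !oppE.
Qed.

(** The inequalities hold in both directions, through [S] and through its inverse. *)
Lemma sylvester_inertia A B S :
    A \is hermsymmx -> B \is hermsymmx -> S \in unitmx ->
  B = S *m A *m S^t* -> inertia B = inertia A.
Proof.
move=> hA hB Su BS; have AS : A = invmx S *m B *m (invmx S)^t*.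
  rewrite BS -!mulmxA -adjmxM mulVmx // trmx1 map_mx1 mulmx1.
  by rewrite mulmxA mulVmx // mul1mx.
have [posBA negBA] := count_eigenvalues_congr hA hB BS.
have [posAB negAB] := count_eigenvalues_congr hB hA AS.
have pos := anti_leq (introT andP (conj posBA posAB)).
have neg := anti_leq (introT andP (conj negBA negAB)).
have triple (a b c a' b' c' k : nat) : a = a' -> c = c' ->
    (a + b + c = k -> a' + b' + c' = k -> (a, b, c) = (a', b', c'))%N.
  by move=> -> -> <- /addIn/addnI ->.
exact: triple pos neg (inertia_sum hB) (inertia_sum hA).
Qed.
End Inertia.

(** * The real square root of [invmx M *m A] and the conclusion *)

(** Conjugation fixes the coefficients of [p], so the relation passes from [B] to its powers and
    their real combinations. *)
Lemma horner_mx_adj (R : realType) n (B M : 'M[R[i]]_n.+1) (p : {poly R}) :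
    M *m B = B^t* *m M ->
  M *m horner_mx B (map_poly (real_complex R) p) =
  (horner_mx B (map_poly (real_complex R) p))^t* *m M.
Proof.
move=> MB; elim/poly_ind: p => [|p c IHp].
  by rewrite !rmorph0 mulmx0 trmx0 map_mx0 mul0mx.
rewrite !rmorphD !rmorphM /= map_polyX map_polyC /= horner_mx_X horner_mx_C.
set H := horner_mx B _ in IHp *.
have HB : H *m B = B *m H by apply/comm_horner_mx.
rewrite mulmxDr -[_ * B]/(_ *m B) linearD /= map_mxD mulmxDl.
rewrite tr_scalar_mx map_scalar_mx /= conj_Creal; last by apply/complex_realP; exists c.
rewrite scalar_mxC; congr (_ + _).
by rewrite {1}HB mulmxA MB -mulmxA IHp mulmxA -adjmxM.
Qed.

Lemma eigenvalue_mulVmxB (F : fieldType) n (A M : 'M[F]_n) (a : F) :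
    M \in unitmx -> eigenvalue (invmx M *m A) a ->
  eigenvalue (invmx M *m (M - A)) (1 - a).
Proof.
move=> Mu /eigenvalueP[v va v0]; apply/eigenvalueP; exists v => //.
by rewrite mulmxBr mulVmx // mulmxBr mulmx1 va scalerBl scale1r.
Qed.

Theorem mainTheorem2 (R : realType) (n : nat) (A M : 'M[R[i]]_n)
    (hermA : A \is hermsymmx) (hermM : M \is hermsymmx)
    (unitA : A \in unitmx) (unitM : M \in unitmx)
    (inertiaAM : inertia A <> inertia M) :
  (exists2 l : R, l < 0 & eigenvalue (invmx M *m A) l%:C) /\
  (let N := M - A in ~ contractive M N).
Proof.
suff [l l0 lP] : exists2 l : R, l < 0 & eigenvalue (invmx M *m A) l%:C.
  split; first by exists l.
  (* The iteration matrix has the eigenvalue [1 - l], which exceeds 1. *)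
  move=> N /(_ _ (eigenvalue_mulVmxB unitM lP)).
  rewrite ger0_norm ?subr_ge0 ?lecR; last by rewrite (le_trans (ltW l0)).
  by rewrite ltrBlDr ltrDl ltcR ltNge ltW.
(* [horner_mx] requires positive dimension; in dimension 0 all matrices coincide. *)
case: n => [|n] in A M hermA hermM unitA unitM inertiaAM *.
  by case: inertiaAM; rewrite (flatmx0 A) (flatmx0 M).
set B := invmx M *m A.
have eigB z : (z \in eigenvalues B) = eigenvalue B z.
  by rewrite eigenvalue_root_char char_poly_eigenvalues root_prod_XsubC.
have [/hasP[z]|/hasPn noneg] := boolP (has (fun z => z < 0) (eigenvalues B)).
  rewrite eigB; case: z => x y zB; rewrite ltcE /= => /andP[/eqP y0 x0].
  exists x; first exact: x0.
  by rewrite -complexr0 [X in _ +i* X]y0; exact: zB.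
case: inertiaAM.
have AE : A = M *m B by rewrite mulKVmx.
have Bu : B \in unitmx by rewrite unitmx_mul unitmx_inv unitM.
have [|p pP] := @real_sqrt_modp R (eigenvalues B).
  move=> z zB; split; last exact: noneg.
  apply: contraTneq zB => ->; rewrite eigB; apply/negP => /eigenvalueP[v vB v0].
  by case/eqP: v0; rewrite -(mulmxK Bu v) vB scale0r mul0mx.
pose S := horner_mx B (map_poly (real_complex R) p).
(* [char_poly B] divides [p ^+ 2 - 'X], so Cayley-Hamilton gives the identity. *)
have SS : S *m S = B.
  move: pP; rewrite -char_poly_eigenvalues => /dvdpP[q /(congr1 (horner_mx B))].
  rewrite !rmorphB rmorphXn /= map_polyX rmorphXn rmorphM /= horner_mx_X.
  by rewrite Cayley_Hamilton mulr0 => /eqP; rewrite subr_eq0 => /eqP.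
have MS : M *m S = S^t* *m M.
  (* Since [A] and [M] are Hermitian, both [M *m B] and [B^t* *m M] equal [A]. *)
  apply: horner_mx_adj; rewrite -AE adjmxM (hermsymmxP _ hermA).
  by rewrite -mulmxA -{2}(hermsymmxP _ hermM) -adjmxM mulmxV // trmx1 map_mx1 mulmx1.
apply: (@sylvester_inertia _ _ _ _ (S^t*)) => //.
  rewrite map_unitmx unitmx_tr.
  have [] // := @mulmx1_unit _ _ S (S *m invmx B).
  by rewrite mulmxA SS mulmxV.
by rewrite trmxCK -MS -mulmxA SS.
Qed.
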